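(* Let $\mathbf{c}=(c_n)_{n\ge 1}$ be an oscillating sequence of complex numbers satisfying the growth condition $\sum_{n=1}^N |c_n|^{\lambda}=O(N)$ for some $\lambda>1$. Then $\mathbf{c}$ is linearly disjoint from every flow $\mathcal{X}=(X,T)$ that is both MMA and MMLS. More precisely, for every such flow and every continuous function $f: X\to\mathbb{C}$, $$\lim_{N\to\infty}\frac1N\sum_{n=1}^N c_n f(T^n x)=0$$ for every $x\in X$, and the limit is uniform on each minimal subset of $X$.
   Context: A flow $\mathcal{X}=(X,T)$ is a compact metric space $(X,d)$ together with a continuous map $T:X\to X$. A sequence $(c_n)_{n\ge1}$ of complex numbers is oscillating if $\lim_{N\to\infty}\frac1N\sum_{n=1}^N c_n e^{-2\pi i n t}=0$ for every $t\in[0,1)$. A sequence $(c_n)$ is linearly disjoint from $(X,T)$ if $\lim_{N\to\infty}\frac1N\sum_{n=1}^N c_n f(T^n x)=0$ for every continuous $f:X\to\mathbb{C}$ and every $x\in X$. A minimal subset $K\subseteq X$ is a non-empty closed subset with $T(K)\subseteq K$ such that $T:K\to K$ is minimal (every forward orbit in $K$ is dense in $K$). The upper density of $E\subseteq\mathbb{N}$ is $\overline{D}(E)=\limsup_{n\to\infty}\frac{\#(E\cap[1,n])}{n}$. A flow is mean-L-stable (MLS) if for every $\epsilon>0$ there is $\delta>0$ such that $d(x,y)<\delta$ implies $d(T^nx,T^ny)<\epsilon$ for all $n=0,1,2,\dots$ except for a set of natural numbers of upper density less than $\epsilon$. A flow $(X,T)$ is minimally mean-L-stable (MMLS) if for every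 minimal subset $K\subseteq X$ the sub-flow $(K,T)$ is MLS. Given a minimal subset $K$, a point $x\in X$ is mean attracted to $K$ if for every $\epsilon>0$ there is $z=z_{\epsilon,x}\in K$ with $\limsup_{N\to\infty}\frac1N\sum_{n=1}^N d(T^nx,T^nz)<\epsilon$; $\mathrm{Basin}(K)$ is the set of all points mean attracted to $K$. A flow is minimally mean attractable (MMA) if $X=\bigcup_K \mathrm{Basin}(K)$, where $K$ ranges over all minimal subsets of $X$. *)

(* Defs.v *)
(* The complex numbers over R : realType are R[i]; the topology of the complex
   norm is only available on the regular module R[i]^o (convertible to R[i]), so
   continuity and limits of complex-valued functions are stated there. *)
From HB Require Import structures.
From mathcomp Require Import all_boot all_order all_algebra.
From mathcomp Require Import finmap.
From mathcomp Require Import all_classical all_reals all_analysis.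
From mathcomp Require Import complex.
Set Implicit Arguments.
Unset Strict Implicit.
Unset Printing Implicit Defensive.
Import Order.TTheory GRing.Theory Num.Theory.
Import numFieldNormedType.Exports.
Local Open Scope classical_set_scope.
Local Open Scope ring_scope.
Local Open Scope complex_scope.

(* Sequences are 1-indexed: u 0 is not used, and average u 0 = 0. *)
Definition average (F : fieldType) (u : nat -> F) (N : nat) : F :=
  N%:R^-1 * \sum_(1 <= n < N.+1) u n.

(* exp (i theta) *)
Definition expi (R : realType) (theta : R) : R[i] := cos theta +i* sin theta.

Definition oscillating (R : realType) (c : nat -> R[i]) : Prop :=
  forall t : R, 0 <= t -> t < 1 ->
    average (fun n => c n * expi (- (2 * pi * n%:R * t))) @ \oo --> (0 : R[i]^o).

Definition growth_condition (R : realType) (c : nat -> R[i]) (lambda : R)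
    : Prop :=
  (fun N : nat => \sum_(1 <= n < N.+1) (Normc.normc (c n) `^ lambda))
    =O_\oo (fun N : nat => N%:R : R).

Definition weighted_average (R : realType) (X : Type) (c : nat -> R[i])
    (T : X -> X) (f : X -> R[i]^o) (N : nat) (x : X) : R[i]^o :=
  average (fun n => c n * f (iter n T x)) N.

Definition linearly_disjoint (R : realType) (X : metricType R)
    (c : nat -> R[i]) (T : X -> X) : Prop :=
  forall f : X -> R[i]^o, continuous f -> forall x : X,
    weighted_average c T f ^~ x @ \oo --> (0 : R[i]^o).

Definition minimal_subset (R : realType) (X : metricType R) (T : X -> X)
    (K : set X) : Prop :=
  [/\ K !=set0, closed K, T @` K `<=` K &
      forall x, K x -> K `<=` closure (range (fun n => iter n T x))].

Definition upper_density (R : realType) (E : set nat) : \bar R :=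
  limn_esup (fun n : nat =>
    ((#|` fset_set (E `&` [set k | (1 <= k <= n)%N]) |)%:R / n%:R : R)%:E).

(* Mean-L-stability of the sub-flow (K, T), for K invariant under T; the
   metric and the iterates of the sub-flow are the restrictions of those of
   (X, T), so (X, T) itself is the case K = [set: X]. *)
Definition mean_L_stable (R : realType) (X : metricType R) (T : X -> X)
    (K : set X) : Prop :=
  forall e : R, 0 < e -> exists2 d : R, 0 < d &
    forall x y : X, K x -> K y -> mdist x y < d ->
      exists2 E : set nat, (upper_density R E < e%:E)%E &
        forall n : nat, ~ E n -> mdist (iter n T x) (iter n T y) < e.

Definition MMLS (R : realType) (X : metricType R) (T : X -> X) : Prop :=
  forall K : set X, minimal_subset T K -> mean_L_stable T K.

Definition mean_attracted (R : realType) (X : metricType R) (T : X -> X)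
    (K : set X) (x : X) : Prop :=
  forall e : R, 0 < e -> exists2 z : X, K z &
    (limn_esup (fun N =>
       (average (fun n => mdist (iter n T x) (iter n T z)) N)%:E) < e%:E)%E.

Definition basin (R : realType) (X : metricType R) (T : X -> X)
    (K : set X) : set X := [set x | mean_attracted T K x].

Definition MMA (R : realType) (X : metricType R) (T : X -> X) : Prop :=
  [set: X] = \bigcup_(K in [set K | minimal_subset T K]) basin T K.

(* Main.v *)
Require Import Defs.
From HB Require Import structures.
From mathcomp Require Import all_boot all_order all_algebra.
From mathcomp Require Import finmap.
From mathcomp Require Import all_classical all_reals all_analysis.
From mathcomp Require Import complex.
From mathcomp Require Import ring lra zify.
Set Implicit Arguments.
Unset Strict Implicit.
Unset Printing Implicit Defensive.

Import Order.TTheory GRing.Theory Num.Theory.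
Import numFieldNormedType.Exports.
Local Open Scope classical_set_scope.
Local Open Scope ring_scope.
Local Open Scope complex_scope.

(** The proof compares the sequence [a n = f (T^n x)], for [x] in a minimal set
    [K], with trigonometric sums.

    _The minimal flow._  Mean-L-stability says that the orbits of nearby points
    of [K] are eventually close in mean, from a time that may depend on the two
    points.  Baire's theorem makes this time uniform on some ball of [K], and
    minimality transports the bound from that ball to all of [K]
    (minimal_uniform_mean_stability).  Since [K] is totally bounded, [a] is then
    almost periodic in the sense of Weyl: its translates fall into finitely many
    classes, and two translates of the same class are close in mean, uniformly
    from some time on (minimal_orbit_weyl_almost_periodic).

    _The sequence theorem_ (average_weyl_almost_periodic).  Let [a] be bounded
    and Weyl almost periodic.  By pigeonhole there is a set [A] of natural
    numbers below [H], of density bounded below independently of [H], such that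
    translating [a] by an element of [A] changes it little in mean.  By the
    growth condition, [c] pairs to almost nothing with a bounded sequence of
    small mean modulus (average_small_factor), so in the average of [c n * a n]
    one may replace [a n] by the mean of [a (n + i + j)] over [i] and [j] in [A].
    Fourier inversion modulo [M = 2 H] expands this double mean into the twisted
    averages [M^-1 * \sum_(m < M) a (n + m) * z ^+ m], where [z ^+ M = 1], with
    weights of total mass at most [M / #|A|], which is bounded
    (normc_double_sum_le).

    It remains to show that [c] is asymptotically orthogonal to these twisted
    averages, uniformly over the frequencies when [M] is large.  For a fixed
    frequency, a long twisted average is, up to the phase [z ^- n], nearly
    independent of [n], by almost periodicity, so that the oscillation of [c]
    applies (average_twisted_small).  A window that works for one frequency
    works for all nearby ones and for all longer windows, and compactness of
    the circle gives uniformity (average_twisted_uniformly_small).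

    _Conclusion._  Uniform mean stability makes the weighted averages eventually
    equicontinuous on [K], so they converge uniformly there.  A point that is
    mean attracted to [K] has, up to a small error, the same weighted averages
    as a point of [K]. *)

(** * The modulus of complex numbers *)

Import Normc.

Section ComplexModulus.
Context {R : realType}.
Implicit Types (x y z : R[i]) (t : R).

Lemma normr_normc z : `|z| = (normc z)%:C.
Proof. by []. Qed.

Lemma normc_ge0 z : 0 <= normc z.
Proof. by case: z => a b; exact: sqrtr_ge0. Qed.

Lemma ler_normcD x y : normc (x + y) <= normc x + normc y.
Proof. exact: le_normcD. Qed.

Lemma normc_opp x : normc (- x) = normc x.
Proof. exact: normcN. Qed.

Lemma normc_distC x y : normc (x - y) = normc (y - x).
Proof. by rewrite -normc_opp opprB. Qed.

Lemma ler_normc_dist z x y : normc (x - y) <= normc (x - z) + normc (z - y).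
Proof. by rewrite -(subrKA z) ler_normcD. Qed.

Lemma ler_normcB x y : normc (x - y) <= normc x + normc y.
Proof. by rewrite (le_trans (ler_normcD _ _))// normc_opp. Qed.

Lemma ler_normc_sum (I : Type) (r : seq I) (P : pred I) (F : I -> R[i]) :
  normc (\sum_(i <- r | P i) F i) <= \sum_(i <- r | P i) normc (F i).
Proof.
elim/big_ind2: _ => //; first by rewrite normc0.
by move=> x1 x2 y1 y2 h1 h2; rewrite (le_trans (ler_normcD _ _))// lerD.
Qed.

Lemma normcX z n : normc (z ^+ n) = normc z ^+ n.
Proof.
elim: n => [|n IH]; first by rewrite !expr0 normc1.
by rewrite !exprS normcM IH.
Qed.

Lemma normc_real t : normc t%:C = `|t|.
Proof. by rewrite /normc /= expr0n /= addr0 sqrtr_sqr. Qed.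

Lemma normc_nat n : normc (n%:R : R[i]) = n%:R.
Proof. by rewrite -(rmorph_nat (real_complex R)) normc_real normr_nat. Qed.

Lemma normc_natV n : normc ((n%:R : R[i])^-1) = n%:R^-1.
Proof. by rewrite normcV normc_nat. Qed.

Lemma normc_expi t : normc (expi t) = 1.
Proof. by rewrite /normc /expi cos2Dsin2 sqrtr1. Qed.

Lemma expiD s t : expi (s + t) = expi s * expi t.
Proof.
rewrite /expi cosD sinD; simpc.
by congr (_ +i* _); ring.
Qed.

Lemma expi0 : expi 0 = 1 :> R[i].
Proof. by rewrite /expi cos0 sin0. Qed.

Lemma expi_neq0 t : expi t != 0.
Proof. by apply/eqP => h; have := normc_expi t; rewrite h normc0; lra. Qed.

Lemma expiN t : expi (- t) = (expi t)^-1.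
Proof.
apply: (mulfI (expi_neq0 t)).
by rewrite -expiD subrr expi0 mulfV// expi_neq0.
Qed.

Lemma expiX t n : expi (n%:R * t) = expi t ^+ n.
Proof.
elim: n => [|n IH]; first by rewrite mul0r expi0 expr0.
by rewrite -natr1 mulrDl mul1r expiD IH exprSr.
Qed.

End ComplexModulus.

(** The topology of [R[i]^o] is indexed by the positive elements of [R[i]],
    which are real; hence real tolerances suffice. *)
Lemma cvg_normcP {R : realType} {T : Type} (F : set_system T) {FF : Filter F}
    (f : T -> R[i]^o) (l : R[i]^o) :
  f @ F --> l <->
  forall e : R, 0 < e -> \forall x \near F, normc (f x - l) <= e.
Proof.
split=> [/cvgrPdist_le h e e0|h].
  have e0C : 0 < e%:C :> R[i] by rewrite ltcR.
  have := h _ e0C; apply: filterS => N.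
  by rewrite -normrN opprB normr_normc lecR.
apply/cvgrPdist_le => -[e i] e0.
have /andP[/eqP i0 e1] : (i == 0) && (0 < e) by move: e0; rewrite ltcE.
have := h e e1; apply: filterS => N.
by rewrite -normrN opprB normr_normc i0 lecR.
Qed.

(** * Uniform integrability in mean *)

Section WeightedMeans.
Context {R : realType}.
Implicit Types (c a h : nat -> R[i]).

Lemma ler_addr_powR (lambda delta : R) : 1 < lambda -> 0 < delta ->
  exists2 rho : R, 0 < rho &
    forall x : R, 0 <= x -> x <= rho + delta * x `^ lambda.
Proof.
move=> l1 d0; have r0 : 0 < lambda - 1 by rewrite subr_gt0.
(* above this height, [delta * x `^ (lambda - 1)] exceeds 1 *)
exists (delta^-1 `^ (lambda - 1)^-1); first by rewrite powR_gt0 ?invr_gt0.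
set rho := _ `^ _; move=> x x0.
have rho0 : 0 < rho by rewrite powR_gt0 ?invr_gt0.
have [xr|rx] := leP x rho.
  by rewrite (le_trans xr)// lerDl mulr_ge0 ?powR_ge0// ltW.
apply: (@le_trans _ _ (delta * x `^ lambda)); last by rewrite lerDr ltW.
rewrite -mulr_powRB1// ?(lt_trans ltr01)// mulrCA ler_peMr//.
have rhoE : rho `^ (lambda - 1) = delta^-1.
  by rewrite -powRrM mulVf ?gt_eqF// powRr1// invr_ge0 ltW.
rewrite -(@ler_pM2l _ delta^-1) ?invr_gt0// mulr1 mulKf ?gt_eqF// -rhoE.
by rewrite ge0_ler_powR// ?nnegrE ltW.
Qed.

Lemma normc_average_le (u : nat -> R[i]) (eta : R) (N : nat) : (0 < N)%N ->
  \sum_(1 <= n < N.+1) normc (u n) <= eta * N%:R -> normc (average u N) <= eta.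
Proof.
move=> N0 h; rewrite /average normcM normc_natV mulrC.
rewrite ler_pdivrMr ?ltr0n//; exact: le_trans (ler_normc_sum _ _ _) h.
Qed.

(** Splitting [c] at a large height shows that it is uniformly integrable in
    mean, so it pairs to almost nothing with a bounded sequence of small mean
    modulus.  This is all that the growth condition is used for. *)
Lemma average_small_factor c (lambda : R) :
  1 < lambda -> growth_condition c lambda ->
  forall B eta : R, 0 < B -> 0 < eta ->
  exists2 eps : R, 0 < eps & \forall N \near \oo, forall h,
    (forall n, normc (h n) <= B) ->
    \sum_(1 <= n < N.+1) normc (h n) <= eps * N%:R ->
    normc (average (fun n => c n * h n) N) <= eta.
Proof.
move=> l1 /eqO_exP[C C0 gC] B eta B0 eta0.
have [//||rho rho0 hrho] := @ler_addr_powR lambda (eta / 2 / (B * C)).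
  by rewrite !divr_gt0// mulr_gt0.
exists (eta / 2 / rho); first by rewrite !divr_gt0.
near=> N => h hB hN.
have N0 : (0 < N)%N by near: N; exists 1%N.
apply: normc_average_le => //.
have gN : \sum_(1 <= n < N.+1) normc (c n) `^ lambda <= C * N%:R.
  have : `|\sum_(1 <= n < N.+1) normc (c n) `^ lambda| <= C * `|N%:R : R|.
    by near: N.
  by rewrite normr_nat; apply: le_trans; exact: ler_norm.
apply: (@le_trans _ _ (\sum_(1 <= n < N.+1) (rho * normc (h n) +
    eta / 2 / C * normc (c n) `^ lambda))).
  apply: ler_sum => n _; rewrite normcM.
  have := hrho _ (normc_ge0 (c n)).
  move=> /(ler_wpM2r (normc_ge0 (h n)))/le_trans; apply.
  rewrite mulrDl lerD2l.
  have -> : eta / 2 / C * normc (c n) `^ lambda =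
      eta / 2 / (B * C) * normc (c n) `^ lambda * B.
    by field; rewrite !gt_eqF.
  apply: ler_wpM2l => //; rewrite !mulr_ge0 ?powR_ge0 ?invr_ge0 ?mulr_ge0//.
  - exact: ltW.
  - exact: ltW.
  - exact: ltW.
rewrite big_split /= -!mulr_sumr.
have -> : eta * N%:R = rho * (eta / 2 / rho * N%:R) + eta / 2 / C * (C * N%:R).
  by field; rewrite !gt_eqF.
apply: lerD; first by rewrite ler_wpM2l// ltW.
by rewrite ler_wpM2l// !divr_ge0// ltW.
Unshelve. all: by end_near. Qed.

End WeightedMeans.

(** * Fourier analysis on a finite cyclic group *)

Section FiniteFourier.
Context {R : realType}.
Implicit Types (t : R) (b : nat -> R[i]).

Definition unit_character t : R[i] := expi (2 * pi * t).

Lemma normc_unit_character t : normc (unit_character t) = 1.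
Proof. exact: normc_expi. Qed.

Lemma unit_character_neq0 t : unit_character t != 0.
Proof. exact: expi_neq0. Qed.

Lemma unit_characterN t : unit_character (- t) = (unit_character t)^-1.
Proof. by rewrite /unit_character mulrN expiN. Qed.

Lemma unit_characterD s t :
  unit_character (s + t) = unit_character s * unit_character t.
Proof. by rewrite /unit_character mulrDr expiD. Qed.

Lemma unit_characterX t n : unit_character (n%:R * t) = unit_character t ^+ n.
Proof. by rewrite /unit_character mulrCA expiX. Qed.

Lemma unit_character1 : unit_character 1 = 1.
Proof.
rewrite /unit_character mulr1 /expi -[2 * pi]/(2%:R * pi) mulr_natl.
by rewrite cos2pi sin2pi.
Qed.

Lemma unit_character_neq1 t : 0 < t -> t < 1 -> unit_character t != 1.
Proof.
move=> t0 t1; apply/eqP => -[cos1 _].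
have : 0 < sin (pi * t).
  apply: sin_gt0_pi; rewrite mulr_gt0 ?pi_gt0//=.
  by rewrite -[ltRHS]mulr1 ltr_pM2l ?pi_gt0.
have : cos (pi * t + pi * t) = 1 by rewrite -cos1; congr cos; ring.
rewrite cosD -!expr2; have := cos2Dsin2 (pi * t).
by nra.
Qed.

Lemma conjc_unit_characterXV t n :
  ((unit_character t)^-1 ^+ n)^* = unit_character t ^+ n.
Proof.
rewrite -unit_characterN -!unit_characterX mulrN /unit_character /expi.
by rewrite mulrN cosN sinN /= opprK.
Qed.

Lemma unit_character_orthogonality (M m l : nat) : (m < M)%N -> (l < M)%N ->
  \sum_(k < M) unit_character (k%:R / M%:R) ^+ m *
    (unit_character (k%:R / M%:R))^-1 ^+ l = (if m == l then M%:R else 0).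
Proof.
move=> mM lM; have M0 : (0 < M)%N by exact: leq_ltn_trans mM.
pose w := unit_character ((m%:R - l%:R) / M%:R).
transitivity (\sum_(k < M) w ^+ k).
  apply: eq_bigr => k _; rewrite -unit_characterN -!unit_characterX.
  by rewrite -unit_characterD; congr unit_character; ring.
case: eqVneq => [ml|ml].
  rewrite (eq_bigr (fun=> 1)) ?sumr_const ?card_ord// => k _.
  by rewrite /w ml subrr mul0r /unit_character mulr0 expi0 expr1n.
have w1 : w != 1.
  wlog lm : m l mM lM ml @w / (l < m)%N.
    move=> wl; have [lm|] := ltnP l m; first exact: wl.
    rewrite leq_eqVlt (negbTE ml) => /= /(wl _ _ lM mM).
    rewrite eq_sym => /(_ ml).
    apply: contra => /eqP w1; rewrite -opprB mulNr unit_characterN.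
    by rewrite -/w w1 invr1.
  apply: unit_character_neq1; rewrite -natrB ?(ltnW lm)//.
    by rewrite divr_gt0 ?ltr0n// subn_gt0.
  rewrite ltr_pdivrMr ?ltr0n// mul1r ltr_nat.
  by rewrite (leq_ltn_trans (leq_subr _ _)).
have w10 : w - 1 != 0 by rewrite subr_eq0.
apply: (mulfI w10).
rewrite -subrX1 mulr0 /w -unit_characterX mulrCA mulfV ?pnatr_eq0 -?lt0n//.
rewrite mulr1 unit_characterD unit_characterN.
by rewrite -[m%:R]mulr1 -[l%:R]mulr1 !unit_characterX unit_character1 !expr1n
  invr1 mulr1 subrr.
Qed.

(** The double sum is the value at 0 of the convolution of [b] with two copies
    of the reflected indicator of [A], hence the sum over all frequencies of the
    transform of [b] times the square of that of [A].  By Plancherel the squared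
    moduli of the latter have total mass [M * #|A|], so that a uniform bound on
    the transform of [b] suffices.  The squaring is what makes one such bound
    enough: with a single copy of [A] the weights would only be bounded in mean
    square, and their total mass could grow with [M]. The condition on [M]
    prevents the sums [i + j] from wrapping around. *)
Lemma normc_double_sum_le (H M : nat) (A : {pred 'I_H}) b (eta : R) :
  (H + H <= M)%N ->
  (forall k, (k < M)%N -> normc (M%:R^-1 *
     \sum_(m < M) b m * unit_character (k%:R / M%:R) ^+ m) <= eta) ->
  normc (\sum_(i in A) \sum_(j in A) b (i + j)%N) <= eta * (M%:R * #|A|%:R).
Proof.
move=> HM hb.
pose chi (k : 'I_M) := unit_character (k%:R / M%:R).
pose s (k : 'I_M) := \sum_(j in A) (chi k)^-1 ^+ j.
have lt_M (i j : 'I_H) : (i + j < M)%N.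
  by have := ltn_ord i; have := ltn_ord j; lia.
have lt_M1 (i : 'I_H) : (i < M)%N by have := ltn_ord i; lia.
have [M0|M0] := posnP M.
  rewrite big1 ?normc0 ?M0 ?mul0r ?mulr0// => i _.
  by have := lt_M1 i; rewrite M0.
have MC : M%:R != 0 :> R[i] by rewrite pnatr_eq0 -lt0n.
have -> : \sum_(i in A) \sum_(j in A) b (i + j)%N =
    \sum_(k < M) (M%:R^-1 * \sum_(m < M) b m * chi k ^+ m) * s k ^+ 2.
  (* Fourier inversion on the cyclic group of order [M] *)
  have bE (p : nat) : (p < M)%N -> b p = \sum_(k < M)
      (M%:R^-1 * \sum_(m < M) b m * chi k ^+ m) * (chi k)^-1 ^+ p.
    move=> pM; under eq_bigr => k _.
      rewrite -mulrA mulr_suml mulr_sumr.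
      under eq_bigr => m _ do rewrite -mulrA.
      over.
    rewrite exchange_big /= (bigD1 (Ordinal pM))//= [X in _ + X]big1 ?addr0.
      rewrite -mulr_sumr -mulr_sumr unit_character_orthogonality// eqxx.
      by rewrite mulrCA mulVf// mulr1.
    move=> m mp; rewrite -mulr_sumr -mulr_sumr unit_character_orthogonality//.
    rewrite ifF ?mulr0//; apply/negbTE; apply: contra mp => /eqP mp.
    exact/eqP/val_inj.
  under eq_bigr => i _ do under eq_bigr => j _ do rewrite (bE _ (lt_M i j)).
  under eq_bigr => i _ do rewrite exchange_big /=.
  rewrite exchange_big /=; apply: eq_bigr => k _.
  rewrite expr2 /s mulr_suml mulr_sumr; apply: eq_bigr => i _.
  rewrite mulr_sumr mulr_sumr; apply: eq_bigr => j _.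
  by rewrite exprD.
apply: (le_trans (ler_normc_sum _ _ _)).
apply: (@le_trans _ _ (\sum_(k < M) eta * normc (s k) ^+ 2)).
  apply: ler_sum => k _; rewrite normcM normcX.
  rewrite ler_wpM2r ?exprn_ge0 ?normc_ge0//.
  exact: hb.
rewrite -mulr_sumr le_eqVlt; apply/orP; left; apply/eqP; congr (_ * _).
have sqr_s k : ((normc (s k) ^+ 2)%:C = \sum_(i in A) \sum_(j in A)
    (chi k)^-1 ^+ i * chi k ^+ j)%R.
  rewrite rmorphXn /= -normr_normc normCK mulr_suml.
  apply: eq_bigr => i _; rewrite -mulr_sumr rmorph_sum; congr (_ * _).
  by apply: eq_bigr => j _; exact: conjc_unit_characterXV.
apply: (@complexI R); rewrite rmorph_sum /=.
under eq_bigr => k _ do rewrite sqr_s.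
rewrite exchange_big /= rmorphM /= !rmorph_nat mulrC.
rewrite -sum1_card natr_sum mulr_suml; apply: eq_bigr => i iA.
rewrite exchange_big /= (bigD1 i)//= [X in _ + X]big1 ?addr0.
  under eq_bigr => k _ do rewrite mulrC.
  by rewrite unit_character_orthogonality// eqxx mul1r.
move=> j /andP[_ ji]; under eq_bigr => k _ do rewrite mulrC.
rewrite unit_character_orthogonality// ifF//.
by apply/negbTE; apply: contra ji => /eqP ji; apply/eqP/val_inj.
Qed.

End FiniteFourier.

(** * Finite colorings of compact sets *)

Section Colorings.
Context {R : realType}.

(** A compact set has a finite coloring in which points of equal color are
    close to a common point; colorings make it easy to combine finitely many
    smallness conditions, by taking products of colors. *)
Lemma compact_coloring {Y : topologicalType} (K : set Y) (E : Y -> Y -> Prop) :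
  compact K -> (forall x, K x -> \forall y \near x, E x y) ->
  exists (F : finType) (kappa : Y -> F), forall x y, K x -> K y ->
    kappa x = kappa y -> exists w, [/\ K w, E w x & E w y].
Proof.
rewrite compact_near_coveringP => cK nE.
pose F := filter_from [set: seq Y]
  (fun s => [set s' : seq Y | {subset s <= s'}]).
have FF : Filter F.
  apply: filter_from_filter; first by exists [::].
  move=> s s' _ _; exists (s ++ s') => // r /= sr.
  by split=> x xs; apply: sr; rewrite mem_cat xs ?orbT.
(* near covering for the filter of larger and larger finite sets of centers *)
pose P (s : seq Y) x := exists2 w, w \in s & K w /\ E w x.
have [s _ /(_ s (fun x xs => xs)) Ks] : F [set s | K `<=` P s].
  apply: (cK _ F P) => x Kx.
  exists (E x, [set s : seq Y | {subset [:: x] <= s}]) => /=.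
    by split; [exact: nE|exists [:: x]].
  by move=> -[y s] /= [Exy xs]; exists x => //; apply: xs; rewrite mem_head.
pose kappa x : option (seq_sub s) :=
  if pselect (exists i : seq_sub s, K (val i) /\ E (val i) x) is left h
  then Some (projT1 (cid h)) else None.
exists (option (seq_sub s)), kappa => x y Kx Ky; rewrite /kappa.
have cov w : K w -> exists i : seq_sub s, K (val i) /\ E (val i) w.
  by move=> /Ks[i iS Ei]; exists (SeqSub iS).
case: pselect => [hx|/(_ (cov _ Kx))//].
case: pselect => [hy|/(_ (cov _ Ky))//].
move=> [eq_col]; exists (val (projT1 (cid hx))).
have [KX EX] := projT2 (cid hx); have [_ EY] := projT2 (cid hy).
by split => //; move: eq_col => /= ->.
Qed.

Lemma coloring_representatives (F : finType) (kappa : nat -> F) :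
  exists L, forall n, exists2 l, (l <= L)%N & kappa l = kappa n.
Proof.
pose g f := xget 0%N [set n | kappa n = f].
exists (\max_(f : F) g f)%N => n; exists (g (kappa n)).
  exact: (leq_bigmax (kappa n)).
by apply: (@xgetPex _ 0%N [set m | kappa m = kappa n]); exists n.
Qed.

Lemma normc_le_ReIm (z : R[i]) : normc z <= `|complex.Re z| + `|complex.Im z|.
Proof.
case: z => a b /=; rewrite -[leRHS]ger0_norm ?addr_ge0// -[leRHS]sqrtr_sqr.
rewrite ler_wsqrtr// sqrrD !real_normK ?num_real// lerD2r lerDl.
by rewrite mulrn_wge0// mulr_ge0.
Qed.

Lemma Re_le_normc (z : R[i]) : `|complex.Re z| <= normc z.
Proof.
by case: z => a b /=; rewrite -[leLHS]sqrtr_sqr ler_wsqrtr// lerDl sqr_ge0.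
Qed.

Lemma Im_le_normc (z : R[i]) : `|complex.Im z| <= normc z.
Proof.
by case: z => a b /=; rewrite -[leLHS]sqrtr_sqr ler_wsqrtr// lerDr sqr_ge0.
Qed.

Lemma real_sequence_coloring (u : nat -> R) (B eps : R) : 0 < eps ->
  (forall n, `|u n| <= B) ->
  exists (F : finType) (kappa : nat -> F), forall i j,
    kappa i = kappa j -> `|u i - u j| <= eps.
Proof.
move=> e0 uB; have [||F [kappa hk]] := @compact_coloring R `[-B, B]
  (fun x y => `|x - y| < eps / 2).
- exact: segment_compact.
- move=> x _; have := @cvgr_dist_lt R R^o _ (nbhs x) _ id x (@cvg_id _ _).
  by apply; rewrite divr_gt0.
have uK n : `[- B, B]%classic (u n) by rewrite /= in_itv /= -ler_norml.
exists F, (kappa \o u) => i j /(hk _ _ (uK i) (uK j))[w [_ wi wj]].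
by rewrite (le_trans (ler_distD w _ _))// distrC; lra.
Qed.

Lemma complex_sequence_coloring (u : nat -> R[i]) (B eps : R) : 0 < eps ->
  (forall n, normc (u n) <= B) ->
  exists (F : finType) (kappa : nat -> F), forall i j,
    kappa i = kappa j -> normc (u i - u j) <= eps.
Proof.
move=> e0 uB; have e20 : 0 < eps / 2 by rewrite divr_gt0.
have [|F [kappa hk]] := @real_sequence_coloring (@complex.Re R \o u) B _ e20.
  by move=> n; rewrite (le_trans (Re_le_normc _)).
have [|G [mu hmu]] := @real_sequence_coloring (@complex.Im R \o u) B _ e20.
  by move=> n; rewrite (le_trans (Im_le_normc _)).
exists (F * G)%type, (fun n => (kappa n, mu n)) => i j [/hk hR /hmu hI].
rewrite (le_trans (normc_le_ReIm _))// [leRHS]splitr.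
by move: hR hI => /=; case: (u i) (u j) => [a b] [p q] /= hR hI; exact: lerD.
Qed.

End Colorings.

(** * Weyl almost periodic sequences *)

Section WeylAlmostPeriodic.
Context {R : realType}.
Implicit Types (a c g h : nat -> R[i]) (z : R[i]).

(** The orbit of [a] under the shift is totally bounded for the seminorm
    [limsup_M M^-1 * \sum_(m < M) normc (a m)], with the time at which the
    averages become small uniform over the orbit: almost periodicity in the
    sense of Weyl. *)
Definition weyl_almost_periodic a := forall eps : R, 0 < eps ->
  exists (F : finType) (kappa : nat -> F) (M0 : nat), forall i j,
    kappa i = kappa j -> forall M, (M0 <= M)%N ->
    \sum_(m < M) normc (a (i + m)%N - a (j + m)%N) <= eps * M%:R.

Definition twisted_average z a (M n : nat) : R[i] :=
  M%:R^-1 * \sum_(m < M) a (n + m)%N * z ^+ m.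

Lemma averageD g h N :
  average (fun n => g n + h n) N = average g N + average h N.
Proof. by rewrite /average big_split mulrDr. Qed.

Lemma averageZ z g N : average (fun n => z * g n) N = z * average g N.
Proof. by rewrite /average -mulr_sumr mulrCA. Qed.

Lemma average_sum (I : Type) (r : seq I) (P : pred I) (u : I -> nat -> R[i]) N :
  average (fun n => \sum_(i <- r | P i) u i n) N =
  \sum_(i <- r | P i) average (u i) N.
Proof. by rewrite /average exchange_big mulr_sumr. Qed.

Lemma normc_averageM (M : nat) g (B : R) : (0 < M)%N ->
  (forall m, (m < M)%N -> normc (g m) <= B) ->
  normc (M%:R^-1 * \sum_(m < M) g m) <= B.
Proof.
move=> M0 gB; rewrite normcM normc_natV mulrC ler_pdivrMr ?ltr0n//.
rewrite (le_trans (ler_normc_sum _ _ _))//.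
apply: (@le_trans _ _ (\sum_(m < M) B)).
  by apply: ler_sum => m _; exact: gB.
by rewrite sumr_const card_ord mulr_natr.
Qed.

Lemma normc_shifted_sum (B : R) g (M l : nat) : (forall n, normc (g n) <= B) ->
  normc (\sum_(m < M) g (l + m)%N - \sum_(m < M) g m) <= 2 * B * l%:R.
Proof.
move=> gB; elim: l => [|l IH].
  by rewrite mulr0 (eq_bigr (fun m : 'I_M => g m)) ?subrr ?normc0.
rewrite (le_trans (ler_normc_dist (\sum_(m < M) g (l + m)%N) _ _))//.
rewrite -[l.+1%:R]natr1 mulrDr mulr1 addrC lerD//.
rewrite -sumrB.
rewrite (eq_bigr (fun m : 'I_M => g (l + m.+1)%N - g (l + m)%N)); last first.
  by move=> m _; rewrite addnS.
rewrite -(big_mkord xpredT (fun m => g (l + m.+1)%N - g (l + m)%N)).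
rewrite telescope_sumr// (le_trans (ler_normcB _ _))//.
by rewrite [leRHS]mulrC mulr_natr mulr2n lerD.
Qed.

(** The powers of a unimodular number take values in a compact set, so they have
    finite colorings of their own; products of colors do the rest. *)
Lemma weyl_almost_periodic_twist a z (B : R) : 0 < B ->
  (forall n, normc (a n) <= B) -> normc z = 1 -> weyl_almost_periodic a ->
  weyl_almost_periodic (fun n => a n * z ^+ n).
Proof.
move=> B0 aB z1 apa eps e0.
have e20 : 0 < eps / 2 by rewrite divr_gt0.
have [F [kappa [M0 hk]]] := apa _ e20.
have zX n : normc (z ^+ n) = 1 by rewrite normcX z1 expr1n.
have [|n|G [mu hm]] := @complex_sequence_coloring R (fun n => z ^+ n) 1
  (eps / 2 / B).
- by rewrite divr_gt0.
- by rewrite zX.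
exists (F * G)%type, (fun n => (kappa n, mu n)), M0 => i j [ki mi] M MM.
apply: (@le_trans _ _ (\sum_(m < M)
    (normc (a (i + m)%N - a (j + m)%N) + eps / 2))).
  apply: ler_sum => m _.
  have -> : a (i + m)%N * z ^+ (i + m) - a (j + m)%N * z ^+ (j + m) =
    (a (i + m)%N - a (j + m)%N) * z ^+ (i + m) +
    a (j + m)%N * ((z ^+ i - z ^+ j) * z ^+ m) by rewrite !exprD; ring.
  rewrite (le_trans (ler_normcD _ _))// !normcM !zX !mulr1 lerD2l.
  have -> : eps / 2 = B * (eps / 2 / B) by field; rewrite gt_eqF.
  by apply: ler_pM => //; [exact: normc_ge0|exact: normc_ge0|exact: hm].
rewrite big_split /= sumr_const card_ord -[_ / 2 *+ M]mulr_natr.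
rewrite [eps in leRHS]splitr mulrDl.
by rewrite lerD2r; exact: hk.
Qed.

(** A long average hardly feels a bounded shift, and every shift looks like one
    of finitely many: the averages of [g] are uniform in their starting time. *)
Lemma weyl_almost_periodic_uniform_mean g (B : R) : 0 < B ->
  (forall n, normc (g n) <= B) -> weyl_almost_periodic g ->
  forall eps : R, 0 < eps -> \forall M \near \oo, (0 < M)%N /\ forall n,
    normc (M%:R^-1 * \sum_(m < M) g (n + m)%N - M%:R^-1 * \sum_(m < M) g m)
      <= eps.
Proof.
move=> B0 gB apg eps e0; have e20 : 0 < eps / 2 by rewrite divr_gt0.
have [F [kappa [M0 hk]]] := apg _ e20.
have [L hL] := coloring_representatives kappa.
near=> M.
have M_gt0 : (0 < M)%N by near: M; exists 1%N.
have MM : (M0 <= M)%N by near: M; exists M0.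
have LM : 2 * B * L%:R <= eps / 2 * M%:R.
  by rewrite -ler_pdivrMl//; near: M; exact: nbhs_infty_ger.
split=> // n; have [l lL kl] := hL n.
rewrite -mulrBr normcM normc_natV mulrC ler_pdivrMr ?ltr0n//.
rewrite (le_trans (ler_normc_dist (\sum_(m < M) g (l + m)%N) _ _))//.
rewrite [eps]splitr mulrDl lerD//.
  rewrite -sumrB (le_trans (ler_normc_sum _ _ _))//.
  exact: (hk _ _ (esym kl)).
rewrite (le_trans (normc_shifted_sum _ _ gB))// (le_trans _ LM)//.
by rewrite ler_pM2l ?mulr_gt0// ler_nat.
Unshelve. all: by end_near. Qed.

Lemma twisted_average_shift z a (M n : nat) : z != 0 ->
  twisted_average z a M n = z ^- n *
    (M%:R^-1 * \sum_(m < M) a (n + m)%N * z ^+ (n + m)).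
Proof.
move=> z0; rewrite /twisted_average mulrCA; congr (_ * _).
rewrite mulr_sumr; apply: eq_bigr => m _.
by rewrite exprD mulrCA mulKf ?expf_neq0.
Qed.

Lemma normc_subX z w n : normc z = 1 -> normc w = 1 ->
  normc (z ^+ n - w ^+ n) <= n%:R * normc (z - w).
Proof.
move=> z1 w1; elim: n => [|n IH]; first by rewrite !expr0 subrr normc0 mul0r.
have -> : z ^+ n.+1 - w ^+ n.+1 = z * (z ^+ n - w ^+ n) + (z - w) * w ^+ n.
  by rewrite !exprS; ring.
rewrite (le_trans (ler_normcD _ _))// !normcM z1 normcX w1 expr1n mul1r mulr1.
by rewrite -natr1 mulrDl mul1r lerD2r.
Qed.

(** A short twisted average, averaged along a long window with the same twist,
    gives the long twisted average up to the effect of the short shifts. *)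
Lemma twisted_average_refine z a (B : R) (M1 M n : nat) : 0 < B ->
  (0 < M1)%N -> (0 < M)%N -> (forall n, normc (a n) <= B) -> normc z = 1 ->
  normc (twisted_average z a M n -
    M%:R^-1 * \sum_(j < M) z ^+ j * twisted_average z a M1 (n + j)) <=
  2 * B * M1%:R / M%:R.
Proof.
move=> B0 M10 M0 aB z1; pose g m := a (n + m)%N * z ^+ m.
have gB m : normc (g m) <= B by rewrite normcM normcX z1 expr1n mulr1.
have -> : M%:R^-1 * \sum_(j < M) z ^+ j * twisted_average z a M1 (n + j) =
    M1%:R^-1 * \sum_(m < M1) (M%:R^-1 * \sum_(j < M) g (m + j)%N).
  under eq_bigr => j _ do rewrite /twisted_average mulrCA.
  rewrite -mulr_sumr mulrCA; congr (_ * _); rewrite -mulr_sumr; congr (_ * _).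
  under eq_bigr => j _ do rewrite mulr_sumr.
  rewrite exchange_big; apply: eq_bigr => m _; apply: eq_bigr => j _.
  have -> : (n + j + m = n + (m + j))%N by lia.
  by rewrite /g exprD; ring.
have -> : twisted_average z a M n =
    M1%:R^-1 * \sum_(m < M1) (M%:R^-1 * \sum_(j < M) g j).
  rewrite sumr_const card_ord -[X in _ = _^-1 * X]mulr_natl mulKf//.
  by rewrite pnatr_eq0 -lt0n.
rewrite -mulrBr -sumrB.
apply: (@normc_averageM M1 (fun m => M%:R^-1 * \sum_(j < M) g j -
  M%:R^-1 * \sum_(j < M) g (m + j)%N)) => // m mM1.
rewrite -mulrBr normcM normc_natV mulrC ler_pM2r ?invr_gt0 ?ltr0n//.
rewrite normc_distC (le_trans (normc_shifted_sum _ _ gB))//.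
by rewrite ler_pM2l ?mulr_gt0// ler_nat ltnW.
Qed.

End WeylAlmostPeriodic.

(** * Oscillating sequences against twisted averages *)

Section OscillatingAgainstAlmostPeriodic.
Context {R : realType}.
Implicit Types (a c g h : nat -> R[i]) (t : R).

Lemma oscillating_unit_character c t : oscillating c -> 0 <= t -> t <= 1 ->
  forall e : R, 0 < e -> \forall N \near \oo,
    normc (average (fun n => c n * (unit_character t)^- n) N) <= e.
Proof.
move=> osc t0 t1 e e0.
have osc01 s : 0 <= s -> s < 1 -> \forall N \near \oo,
    normc (average (fun n => c n * (unit_character s)^- n) N) <= e.
  move=> s0 s1; have /cvg_normcP/(_ _ e0) := osc s s0 s1.
  apply: filterS => N; rewrite subr0; congr (_ <= _).
  congr (normc (average _ N)).
  apply/funext => n; rewrite expiN; congr (_ * _^-1).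
  by rewrite -unit_characterX /unit_character; congr expi; ring.
have [tl|] := ltP t 1; first exact: osc01.
move=> t1'; have -> : t = 1 by apply/eqP; rewrite eq_le t1 t1'.
have := osc01 0 (lexx _) ltr01.
by rewrite unit_character1 /unit_character mulr0 expi0.
Qed.

Lemma near_unit_character t (e : R) : 0 < e ->
  \forall s \near t, normc (unit_character s - unit_character t) <= e.
Proof.
move=> e0; have e20 : 0 < e / 2 by rewrite divr_gt0.
have c1 : (fun s : R => cos (2 * pi * s)) @ t --> cos (2 * pi * t).
  apply: (@continuous_comp _ _ _ (fun s : R => 2 * pi * s) (@cos R)).
    exact: mulrl_continuous.
  exact: continuous_cos.
have c2 : (fun s : R => sin (2 * pi * s)) @ t --> sin (2 * pi * t).
  apply: (@continuous_comp _ _ _ (fun s : R => 2 * pi * s) (@sin R)).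
    exact: mulrl_continuous.
  exact: continuous_sin.
near=> s; rewrite (le_trans (normc_le_ReIm _))// [e]splitr lerD//=.
  by rewrite distrC; near: s; exact: (@cvgr_dist_le _ _ _ _ _ _ _ c1).
by rewrite distrC; near: s; exact: (@cvgr_dist_le _ _ _ _ _ _ _ c2).
Unshelve. all: by end_near. Qed.

Section FixedSequences.
Context (c : nat -> R[i]) (lambda : R).
Context (osc : oscillating c) (lambda1 : 1 < lambda).
Context (growth : growth_condition c lambda).
Context (a : nat -> R[i]) (B : R) (B0 : 0 < B).
Context (aB : forall n, normc (a n) <= B) (apa : weyl_almost_periodic a).

Lemma average_uniformly_small_factor (eta : R) : 0 < eta ->
  exists2 eps : R, 0 < eps & \forall N \near \oo, forall h,
    (forall n, normc (h n) <= eps) ->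
    normc (average (fun n => c n * h n) N) <= eta.
Proof.
move=> eta0.
have [eps e0 he] := average_small_factor lambda1 growth ltr01 eta0.
have m0 : 0 < Num.min 1 eps by rewrite lt_min ltr01.
exists (Num.min 1 eps) => //.
apply: filterS he => N hN h hm; apply: hN => [n|].
  by rewrite (le_trans (hm n))// ge_min lexx.
rewrite mulr_natr; apply: (@le_trans _ _ (\sum_(1 <= n < N.+1) eps)).
  by apply: ler_sum => n _; rewrite (le_trans (hm n))// ge_min lexx orbT.
by rewrite sumr_const_nat subSS subn0.
Qed.

(** At a fixed frequency a long twisted average of [a] is, up to its phase,
    nearly independent of its starting time; the phase is one of those that an
    oscillating sequence averages out. *)
Lemma average_twisted_small t (eta : R) : 0 <= t -> t <= 1 -> 0 < eta ->
  exists2 M : nat, (0 < M)%N & \forall N \near \oo, forall j,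
    normc (average (fun n =>
      c n * twisted_average (unit_character t) a M (n + j)) N) <= eta.
Proof.
move=> t0 t1 eta0; have eta20 : 0 < eta / 2 by rewrite divr_gt0.
set z := unit_character t.
have z1 : normc z = 1 by exact: normc_unit_character.
have z0 : z != 0 by exact: unit_character_neq0.
have zX n : normc (z ^- n) = 1 by rewrite normcV normcX z1 expr1n invr1.
have [eps e0 he] := average_uniformly_small_factor eta20.
have gB n : normc (a n * z ^+ n) <= B by rewrite normcM normcX z1 expr1n mulr1.
have apg := weyl_almost_periodic_twist B0 aB z1 apa.
have [M [M0 hM]] :=
  filter_ex (weyl_almost_periodic_uniform_mean B0 gB apg e0).
exists M => //; set k := M%:R^-1 * _ in hM.
have kB : normc k <= B by apply: (@normc_averageM R M (fun m => a m * z ^+ m)).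
have d0 : 0 < eta / 2 / B by rewrite divr_gt0.
have hosc := oscillating_unit_character osc t0 t1 d0; rewrite -/z in hosc.
near=> N => j.
have -> : (fun n => c n * twisted_average z a M (n + j)) = (fun n =>
    (k * z ^- j) * (c n * z ^- n) +
    c n * (twisted_average z a M (n + j) - z ^- (n + j) * k)).
  by apply/funext => n; rewrite exprD invfM; ring.
rewrite averageD averageZ (le_trans (ler_normcD _ _))// [eta]splitr lerD//.
  rewrite normcM [normc (k * _)]normcM zX mulr1.
  have -> : eta / 2 = B * (eta / 2 / B) by field; rewrite gt_eqF.
  apply: ler_pM => //; try exact: normc_ge0.
  by near: N.
move: j; near: N; apply: filterS he => N he j; apply: he => n.
by rewrite twisted_average_shift// -mulrBr normcM zX mul1r.
Unshelve. all: by end_near. Qed.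

(** The window length can be chosen independently of the frequency: a window
    that works at one frequency works at nearby ones, long windows are averages
    of shorter ones, and the frequencies form a compact set. *)
Lemma average_twisted_uniformly_small (eta : R) : 0 < eta ->
  \forall M \near \oo, forall t, 0 <= t -> t <= 1 -> \forall N \near \oo,
    normc (average (fun n =>
      c n * twisted_average (unit_character t) a M n) N) <= eta.
Proof.
move=> eta0; have eta20 : 0 < eta / 2 by rewrite divr_gt0.
pose P (M : nat) t := \forall N \near \oo, normc (average (fun n =>
  c n * twisted_average (unit_character t) a M n) N) <= eta.
suff : \forall M \near \oo, `[0, 1] `<=` P M.
  by apply: filterS => M hM t t0 t1; apply: hM; rewrite /= in_itv /= t0 t1.
apply: (iffLR (compact_near_coveringP _) (@segment_compact R 0 1)) => s.
rewrite /= in_itv /= => /andP[s0 s1].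
have [M1 M10 hM1] := average_twisted_small s0 s1 eta20.
have [eps e0 he] := average_uniformly_small_factor eta20.
have e20 : 0 < eps / 2 by rewrite divr_gt0.
have d0 : 0 < eps / 2 / (B * M1%:R) by rewrite divr_gt0// mulr_gt0// ltr0n.
near=> t M.
have M0 : (0 < M)%N by near: M; exists 1%N.
have MM1 : 2 * B * M1%:R / M%:R <= eps / 2.
  rewrite ler_pdivrMr ?ltr0n// -ler_pdivrMl//; near: M; exact: nbhs_infty_ger.
have ts : normc (unit_character t - unit_character s) <= eps / 2 / (B * M1%:R).
  by near: t; exact: near_unit_character.
pose z := unit_character t.
have z1 : normc z = 1 by exact: normc_unit_character.
pose w := unit_character s.
have w1 : normc w = 1 by exact: normc_unit_character.
pose h n := twisted_average z a M n -
  M%:R^-1 * \sum_(j < M) z ^+ j * twisted_average w a M1 (n + j).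
have hsmall n : normc (h n) <= eps.
  rewrite [eps]splitr /h.
  rewrite (le_trans (ler_normc_dist
    (M%:R^-1 * \sum_(j < M) z ^+ j * twisted_average z a M1 (n + j)) _ _))//.
  rewrite lerD//.
    exact: le_trans (twisted_average_refine _ _ _ _ _ _) MM1.
  rewrite -mulrBr -sumrB.
  apply: (@normc_averageM R M (fun j =>
    z ^+ j * twisted_average z a M1 (n + j) -
    z ^+ j * twisted_average w a M1 (n + j))) => // j _.
  rewrite -mulrBr normcM normcX z1 expr1n mul1r /twisted_average -mulrBr -sumrB.
  apply: (@normc_averageM R M1 (fun m => a (n + j + m)%N * z ^+ m -
    a (n + j + m)%N * w ^+ m)) => // m mM1.
  rewrite -mulrBr normcM.
  have -> : eps / 2 = B * (M1%:R * (eps / 2 / (B * M1%:R))).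
    by field; rewrite pnatr_eq0 -lt0n M10 gt_eqF.
  apply: ler_pM => //; try exact: normc_ge0.
  rewrite (le_trans (normc_subX _ z1 w1))//.
  by apply: ler_pM => //; [exact: normc_ge0|rewrite ler_nat ltnW].
near=> N.
have -> : (fun n => c n * twisted_average z a M n) = (fun n =>
    M%:R^-1 * \sum_(j < M) z ^+ j * (c n * twisted_average w a M1 (n + j)) +
    c n * h n).
  apply/funext => n; rewrite /h.
  under [in RHS]eq_bigr => j _ do rewrite mulrCA.
  by rewrite -mulr_sumr; ring.
rewrite averageD averageZ average_sum (le_trans (ler_normcD _ _))//.
rewrite [eta]splitr lerD//; last first.
  by move: (h) hsmall; near: N; exact: he.
apply: (@normc_averageM R M (fun j => average (fun n =>
  z ^+ j * (c n * twisted_average w a M1 (n + j))) N)) => // j _.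
rewrite averageZ normcM normcX z1 expr1n mul1r; move: j.
by near: N; exact: hM1.
Unshelve. all: by end_near. Qed.

End FixedSequences.

(** Pigeonhole. Translating each color class back to its first occurrence keeps
    it among the natural numbers and costs no density. *)
Lemma frequent_color (F : finType) (kappa : nat -> F) (H : nat) :
  exists l, (H <= #|F| * #|[pred j : 'I_H | kappa (l + j)%N == kappa l]|)%N.
Proof.
apply: contrapT => /forallNP hl.
pose first f := xget 0%N [set n | kappa n = f /\
  forall m, kappa m = f -> (n <= m)%N].
have firstP n : kappa (first (kappa n)) = kappa n /\ (first (kappa n) <= n)%N.
  have [m [km mmin]] : exists m, kappa m = kappa n /\
      forall p, kappa p = kappa n -> (m <= p)%N.
    have ex : exists m, kappa m == kappa n by exists n.
    by have [m /eqP km mmin] := ex_minnP ex; exists m; split => // p /eqP/mmin.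
  have [] := @xgetPex _ 0%N [set n0 | kappa n0 = kappa n /\
    forall m, kappa m = kappa n -> (n0 <= m)%N]; first by exists m.
  by move=> kf fmin; split => //; exact: fmin.
pose A f := [pred j : 'I_H | kappa (first f + j)%N == kappa (first f)].
have cardA f : (#|[pred j : 'I_H | kappa j == f]| <= #|A f|)%N.
  have [i /eqP ki|none] := pickP [pred j : 'I_H | kappa j == f]; last first.
    by rewrite (eq_card0 none).
  pose sh (j : 'I_H) : 'I_H :=
    Ordinal (leq_ltn_trans (leq_subr (first f) j) (ltn_ord j)).
  have leH (j : 'I_H) : kappa j == f -> (first f <= j)%N.
    by move=> /eqP <-; have [] := firstP j.
  rewrite -(@card_in_image _ _ sh); last first.
    move=> j j'; rewrite !inE => /leH fj /leH fj' /(congr1 val) /= e.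
    by apply/val_inj => /=; lia.
  apply: subset_leq_card; apply/fintype.subsetP => _ /mapP[j + ->].
  rewrite mem_enum !inE => kj /=.
  rewrite subnKC ?leH// (eqP kj) eq_sym -ki.
  by have [-> _] := firstP i.
have : (H <= \sum_(f : F) #|A f|)%N.
  rewrite -[leqLHS]card_ord.
  rewrite -sum1_card (partition_big (fun j : 'I_H => kappa j) xpredT)//=.
  by apply: leq_sum => f _; rewrite sum1_card; exact: cardA.
have [F0|F0] := posnP #|F|.
  have := hl 0%N; rewrite F0 mul0n => h; rewrite big1// => f _.
  by have := card0_eq F0 f.
pose K f := #|A f|.
rewrite leqNgt => /negP; apply.
have [f fE] := bigop.eq_bigmax K F0.
apply: (@leq_ltn_trans (#|F| * K f)%N).
  rewrite -sum_nat_const; apply: leq_sum => g _.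
  by rewrite -fE; exact: (leq_bigmax g).
by rewrite ltnNge; apply/negP; exact: hl.
Qed.

End OscillatingAgainstAlmostPeriodic.

(** * Oscillating sequences against almost periodic ones *)

Section SequenceTheorem.
Context {R : realType}.

Lemma sum_shift_le (g : nat -> R) (l K : nat) : (forall n, 0 <= g n) ->
  \sum_(n < K) g (l + n)%N <= \sum_(n < l + K) g n.
Proof. by move=> g0; rewrite big_split_ord /= lerDr sumr_ge0. Qed.

Lemma sum_prefix_le (g : nat -> R) (B : R) (l K : nat) :
  (forall n, 0 <= g n) -> (forall n, g n <= B) ->
  \sum_(n < K) g n <= B * l%:R + \sum_(n < K) g (l + n)%N.
Proof.
move=> g0 gB; apply: (@le_trans _ _ (\sum_(n < l + K) g n)).
  by rewrite addnC big_split_ord /= lerDl sumr_ge0.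
rewrite big_split_ord /= lerD2r mulr_natr.
apply: (@le_trans _ _ (\sum_(n < l) B)).
  by apply: ler_sum => n _; exact: gB.
by rewrite sumr_const card_ord.
Qed.

(** A Weyl almost periodic [a] is close in mean to its translates by a set [A]
    of positive density, hence to its double average over [A + A].  That double
    average only involves the twisted averages of [a], which an oscillating
    sequence kills uniformly; the total weight of the frequencies is bounded in
    terms of the density of [A] alone. *)
Lemma average_weyl_almost_periodic (c a : nat -> R[i]) (lambda B : R) :
  oscillating c -> 1 < lambda -> growth_condition c lambda ->
  0 < B -> (forall n, normc (a n) <= B) -> weyl_almost_periodic a ->
  forall eta : R, 0 < eta ->
    \forall N \near \oo, normc (average (fun n => c n * a n) N) <= eta.
Proof.
move=> osc lambda1 growth B0 aB apa eta eta0.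
have eta20 : 0 < eta / 2 by rewrite divr_gt0.
have BB0 : 0 < 2 * B by rewrite mulr_gt0.
have [eps e0 he] := average_small_factor lambda1 growth BB0 eta20.
have d0 : 0 < eps / 8 by rewrite divr_gt0.
have [F [kappa [M0 hk]]] := apa _ d0.
have F0 : 0 < #|F|%:R :> R.
  by rewrite ltr0n; apply/card_gt0P; exists (kappa 0%N).
have eta'0 : 0 < eta / 4 / #|F|%:R by rewrite !divr_gt0.
have [n0 _ hn0] :=
  average_twisted_uniformly_small osc lambda1 growth B0 aB apa eta'0.
pose H := n0.+1; pose M := (H + H)%N.
have {hn0} htw := hn0 M (leq_trans (leqnSn n0) (leq_addr H H)).
have [l] := frequent_color kappa H; set A := [pred j : 'I_H | _] => HA.
have A0 : 0 < #|A|%:R :> R.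
  by rewrite ltr0n lt0n; apply/negP => /eqP A0; move: HA; rewrite A0 muln0.
have htwk : \forall N \near \oo, forall k : 'I_M,
    normc (average (fun n => c n *
      twisted_average (unit_character (k%:R / M%:R)) a M n) N) <=
    eta / 4 / #|F|%:R.
  apply: filter_forall => k; apply: htw.
    by rewrite divr_ge0.
  by rewrite ler_pdivrMr ?mul1r ?ler_nat ?ltr0n// ltnW.
near=> N.
have N0 : (0 < N)%N by near: N; exists 1%N.
have NH : (H <= N)%N by near: N; exists H.
have NM0 : (M0 <= N)%N by near: N; exists M0.
have Nl : 2 * B * l%:R <= eps / 8 * N%:R.
  by rewrite -ler_pdivrMl//; near: N; exact: nbhs_infty_ger.
have aBB n m : normc (a n - a m) <= 2 * B.
  by rewrite (le_trans (ler_normcB _ _))// mulr_natl mulr2n lerD.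
(* the color of [l] controls the shift by [j] only from time [l] on; the earlier
   times contribute a bounded amount *)
have shiftA (j : 'I_H) (s : nat) : A j -> (s < H)%N ->
    \sum_(1 <= n < N.+1) normc (a (n + s + j)%N - a (n + s)%N) <=
    eps / 2 * N%:R.
  move=> /eqP kj sH; rewrite big_add1 /= big_mkord.
  pose g n := normc (a (n + j)%N - a n).
  have g0 n : 0 <= g n by exact: normc_ge0.
  have gB n : g n <= 2 * B by exact: aBB.
  apply: (@le_trans _ _ (\sum_(n < N) g (s.+1 + n)%N)).
    rewrite le_eqVlt; apply/orP; left; apply/eqP; apply: eq_bigr => n _.
    by rewrite /g; have -> : (n.+1 + s = s.+1 + n)%N by rewrite addSnnS addnC.
  rewrite (le_trans (sum_shift_le _ _ g0))//.
  rewrite (le_trans (sum_prefix_le l _ g0 gB))//.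
  have : \sum_(n < s.+1 + N) g (l + n)%N <= eps / 8 * (s.+1 + N)%:R.
    have := hk _ _ kj (s.+1 + N)%N (leq_trans NM0 (leq_addl _ _)).
    apply: le_trans; rewrite le_eqVlt; apply/orP; left; apply/eqP.
    by apply: eq_bigr => n _; rewrite /g addnAC.
  have : (s.+1 + N)%:R <= 2 * N%:R :> R.
    by rewrite -natrM ler_nat mul2n -addnn leq_add2r (leq_trans sH NH).
  rewrite -(ler_pM2l d0).
  have := mulr_ge0 (ltW e0) (ler0n R N).
  move=> h0 h1 h2; have := lerD Nl (le_trans h2 h1).
  by move: (N%:R) h0 => x; lra.
have heN : forall h, (forall n, normc (h n) <= 2 * B) ->
    \sum_(1 <= n < N.+1) normc (h n) <= eps * N%:R ->
    normc (average (fun n => c n * h n) N) <= eta / 2 by near: N; exact: he.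
have shiftAA (i j : 'I_H) : A i -> A j ->
    normc (average (fun n => c n * (a (n + (i + j))%N - a n)) N) <= eta / 2.
  move=> Ai Aj; apply: (heN (fun n => _)) => [n|]; first exact: aBB.
  apply: (@le_trans _ _ (\sum_(1 <= n < N.+1)
    (normc (a (n + i + j)%N - a (n + i)%N) +
     normc (a (n + 0 + i)%N - a (n + 0)%N)))).
    by apply: ler_sum => n _; rewrite addn0 addnA ler_normc_dist.
  rewrite big_split /= [eps]splitr mulrDl; apply: lerD; exact: shiftA.
pose b m := average (fun n => c n * a (n + m)%N) N.
have hb k : (k < M)%N -> normc (M%:R^-1 *
    \sum_(m < M) b m * unit_character (k%:R / M%:R) ^+ m) <=
    eta / 4 / #|F|%:R.
  move=> kM; have htwN : forall k : 'I_M, normc (average (fun n => c n *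
      twisted_average (unit_character (k%:R / M%:R)) a M n) N) <=
      eta / 4 / #|F|%:R by near: N; exact: htwk.
  rewrite (le_trans _ (htwN (Ordinal kM)))//= le_eqVlt; apply/orP; left.
  apply/eqP; congr normc; rewrite mulr_sumr.
  rewrite (eq_bigr (fun m : 'I_M => average (fun n =>
    (M%:R^-1 * unit_character (k%:R / M%:R) ^+ m) *
    (c n * a (n + m)%N)) N)); last by move=> m _; rewrite averageZ /b; ring.
  rewrite -average_sum; congr (average _ N); apply/funext => n.
  rewrite /twisted_average mulrCA !mulr_sumr; apply: eq_bigr => m _.
  by ring.
have := @normc_double_sum_le R H M A b _ (leqnn _) hb.
set S := \sum_(i in A) _ => hS.
have SE : #|A|%:R * #|A|%:R * average (fun n => c n * a n) N = S -
    \sum_(i in A) \sum_(j in A)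
      average (fun n => c n * (a (n + (i + j))%N - a n)) N.
  rewrite /S -sumrB.
  under eq_bigr => i _ do rewrite -sumrB.
  rewrite (eq_bigr (fun=> \sum_(j in A) average (fun n => c n * a n) N)).
    by rewrite !sumr_const -mulrnA -[RHS]mulr_natl natrM.
  move=> i _; apply: eq_bigr => j _; rewrite /b.
  have -> : average (fun n => c n * (a (n + (i + j))%N - a n)) N =
      average (fun n => c n * a (n + (i + j))%N) N -
      average (fun n => c n * a n) N.
    rewrite -[in RHS]mulN1r -averageZ -averageD; congr (average _ N).
    by apply/funext => n; ring.
  by rewrite opprB addrCA subrr addr0.
rewrite -(@ler_pM2l _ (#|A|%:R * #|A|%:R)) ?mulr_gt0//.
have -> : #|A|%:R * #|A|%:R * normc (average (fun n => c n * a n) N) =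
    normc (#|A|%:R * #|A|%:R * average (fun n => c n * a n) N).
  by rewrite !normcM !normc_nat.
rewrite SE (le_trans (ler_normcB _ _))// [eta in leRHS]splitr mulrDr lerD//.
  apply: (le_trans hS).
  have HA' : H%:R <= #|F|%:R * #|A|%:R :> R by rewrite -natrM ler_nat.
  have -> : #|A|%:R * #|A|%:R * (eta / 2) =
      eta / 4 / #|F|%:R * (2 * (#|F|%:R * #|A|%:R) * #|A|%:R).
    by field; rewrite gt_eqF.
  rewrite ler_wpM2l ?(ltW eta'0)// ler_pM2r// /M natrD.
  by move: HA'; move: (_ * #|A|%:R) => x; lra.
rewrite (le_trans (ler_normc_sum _ _ _))//.
rewrite -mulrA mulr_natl -sumr_const; apply: ler_sum => i Ai.
rewrite (le_trans (ler_normc_sum _ _ _))//.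
by rewrite mulr_natl -sumr_const; apply: ler_sum => j Aj; exact: shiftAA.
Unshelve. all: by end_near. Qed.

End SequenceTheorem.

(** * Compact metric spaces *)

Section CompactMetric.
Context {R : realType} {X : metricType R}.
Implicit Types (x y z w : X) (K : set X) (f : X -> R[i]^o).

Lemma near_mdist_lt x (r : R) : 0 < r -> \forall y \near x, mdist x y < r.
Proof.
move=> r0; have := nbhsx_ballx x r r0.
by rewrite ballEmdist.
Qed.

Lemma near_mdistP x (P : set X) : (\forall y \near x, P y) ->
  exists2 r : R, 0 < r & forall y, mdist x y < r -> P y.
Proof.
move=> /nbhs_ballP[r r0 rP]; exists r => // y xy; apply: rP.
by rewrite ballEmdist.
Qed.

Lemma compact_bounded_modulus f : compact [set: X] -> continuous f ->
  exists2 B : R, 0 < B & forall x, normc (f x) <= B.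
Proof.
move=> cX cf.
have [n _ hn] : \forall n \near \oo,
    [set: X] `<=` (fun x => normc (f x) <= n%:R).
  apply: (iffLR (compact_near_coveringP _) cX) => x _.
  have /cvg_normcP/(_ _ ltr01) fx := cf x.
  near=> y n => /=; rewrite -(subrK (f x) (f y)) (le_trans (ler_normcD _ _))//.
  apply: (@le_trans _ _ (1 + normc (f x))).
    by rewrite lerD2r; near: y.
  by near: n; exact: nbhs_infty_ger.
exists n.+1%:R => // x; rewrite (le_trans (hn n (leqnn _) x I))// ler_nat.
by [].
Unshelve. all: by end_near. Qed.

Lemma compact_uniformly_continuous f : compact [set: X] -> continuous f ->
  forall e : R, 0 < e -> exists2 d : R, 0 < d &
    forall x y, mdist x y < d -> normc (f x - f y) <= e.
Proof.
move=> cX cf e e0; have e20 : 0 < e / 2 by rewrite divr_gt0.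
pose P (n : nat) x :=
  forall y, mdist x y < n.+1%:R^-1 -> normc (f x - f y) <= e.
have [n _ hn] : \forall n \near \oo, [set: X] `<=` P n.
  apply: (iffLR (compact_near_coveringP _) cX) => x _.
  have /cvg_normcP/(_ _ e20)/near_mdistP[d d0 fd] := cf x.
  have d20 : 0 < d / 2 by rewrite divr_gt0.
  near=> y n => y' /= yy'.
  have xy : mdist x y < d / 2 by near: y; exact: near_mdist_lt.
  have nd : n.+1%:R^-1 < d / 2.
    by near: n; exact: (near_infty_natSinv_lt (PosNum d20)).
  rewrite (le_trans (ler_normc_dist (f x) _ _))// [e]splitr lerD//.
    by apply: fd; lra.
  rewrite normc_distC; apply: fd; have := lt_trans yy' nd; clear yy' nd.
  by have := metric_triangle x y y'; lra.
exists n.+1%:R^-1 => // x y; exact: (hn n (leqnn _) x I).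
Unshelve. all: by end_near. Qed.

(** Baire's theorem: closed sets that cover a ball of a closed subset [K] of a
    compact space cannot all be nowhere dense in [K]. *)
Lemma closed_cover_interior K (F : nat -> set X) z (d : R) :
  compact [set: X] -> closed K -> (forall n, closed (F n)) -> K z -> 0 < d ->
  (forall y, K y -> mdist z y < d -> exists n, F n y) ->
  exists n w, K w /\ exists2 r : R, 0 < r &
    forall y, K y -> mdist w y < r -> F n y.
Proof.
move=> cX clK clF Kz d0 cov; apply: contrapT => noint.
have step (s : nat * (X * R)) : exists t : X * R, K s.2.1 -> 0 < s.2.2 ->
    [/\ K t.1, 0 < t.2 & forall p, mdist t.1 p <= t.2 ->
      mdist s.2.1 p < s.2.2 /\ ~ F s.1 p].
  case: s => n [w r] /=.
  have [[Kw r0]|nKr] := pselect (K w /\ 0 < r); last first.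
    by exists (w, r) => Kw r0; case: nKr.
  have [y [Ky [wy nFy]]] : exists y, K y /\ mdist w y < r /\ ~ F n y.
    apply: contrapT => /forallNP ny; apply: noint; exists n, w; split => //.
    exists r => // y Ky wy; apply: contrapT => nFy; apply: (ny y).
    by split.
  have /near_mdistP[s s0 hs] : \forall p \near y, (~` F n) p.
    by apply: open_nbhs_nbhs; split => //; exact: closed_openC.
  exists (y, Num.min (s / 2) ((r - mdist w y) / 2)) => _ _ /=.
  have rwy : 0 < r - mdist w y by rewrite subr_gt0.
  split => //; first by rewrite lt_min !divr_gt0.
  move=> p; rewrite le_min => /andP[p1 p2]; split; last by apply: hs; lra.
  by have := metric_triangle w y p; lra.
(* nested balls, the n-th of which avoids the first n sets *)
have [next hnext] := choice step.
pose fix st n := if n is m.+1 then next (m, st m) else (z, d).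
have stP n : K (st n).1 /\ 0 < (st n).2.
  elim: n => [//|n [IK I0]] /=.
  by have [] := hnext (n, st n) IK I0.
have stS n p : mdist (st n.+1).1 p <= (st n.+1).2 ->
    mdist (st n).1 p < (st n).2 /\ ~ F n p.
  have [sK s0] := stP n; have [_ _ h] := hnext (n, st n) sK s0.
  exact: h.
have nested n k p : mdist (st (n + k)%N).1 p <= (st (n + k)%N).2 ->
    mdist (st n).1 p <= (st n).2.
  elim: k => [|k IH]; first by rewrite addn0.
  by rewrite addnS => /stS[/ltW/IH].
have cK : compact K by apply: subclosed_compact cX _.
have [|p [Kp clp]] := cK ((fun n => (st n).1) @ \oo) _.
  by exists 0%N => // n _ /=; have [] := stP n.
have pball n : mdist (st n).1 p <= (st n).2.
  apply/ler_addgt0Pl => e e0.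
  have : ((fun n => (st n).1) @ \oo) [set q | mdist (st n).1 q <= (st n).2].
    exists n => // m /= nm; apply: (nested n (m - n)%N); rewrite subnKC//.
    by rewrite mdistxx ltW//; have [] := stP m.
  move=> /clp /(_ (near_mdist_lt p e0)) [q [/= q1 q2]].
  have := metric_triangle (st n).1 q p; rewrite [mdist q p]metric_sym; lra.
have [zp _] := stS 0%N p (pball 1%N).
have [n Fp] := cov p Kp zp.
by have [_ ] := stS n p (pball n.+1).
Qed.

Lemma limn_esup_lt_near (u : nat -> \bar R) (e : R) :
  (limn_esup u < e%:E)%E -> \forall n \near \oo, (u n < e%:E)%E.
Proof.
move=> /ereal_inf_lt[_ [V FV <-] Ve]; apply: filterS FV => n Vn.
by apply: le_lt_trans Ve; apply: ereal_sup_ubound; exists n.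
Qed.

Lemma continuous_iter (T : X -> X) n : continuous T -> continuous (iter n T).
Proof.
move=> cT; elim: n => [|n IH] x; first exact: cvg_id.
by apply: (@continuous_comp _ _ _ (iter n T) T); [exact: IH|exact: cT].
Qed.

End CompactMetric.

(** * Minimal mean-L-stable flows *)

Section MinimalFlow.
Context {R : realType} {X : metricType R}.
Context (T : X -> X) (cX : compact [set: X]) (cT : continuous T).
Context (f : X -> R[i]^o) (cf : continuous f).
Context (B : R) (B0 : 0 < B) (fB : forall x, normc (f x) <= B).
Implicit Types (x y z w : X) (K : set X).

Let orbit_gap x y (m : nat) : R := normc (f (iter m T x) - f (iter m T y)).

Let orbit_gap_ge0 x y m : 0 <= orbit_gap x y m.
Proof. exact: normc_ge0. Qed.

Let orbit_gap_le x y m : orbit_gap x y m <= 2 * B.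
Proof. by rewrite (le_trans (ler_normcB _ _))// mulr_natl mulr2n lerD. Qed.

Let orbit_gap_triangle z x y m :
  orbit_gap x y m <= orbit_gap x z m + orbit_gap z y m.
Proof. exact: ler_normc_dist. Qed.

Let orbit_gapC x y m : orbit_gap x y m = orbit_gap y x m.
Proof. exact: normc_distC. Qed.

Lemma upper_density_count (E : set nat) (e : R) :
  (upper_density R E < e%:E)%E ->
  \forall M \near \oo,
    \sum_(1 <= n < M.+1) (if n \in E then 1 else 0 : R) <= e * M%:R.
Proof.
move=> /limn_esup_lt_near; apply: filter_app; near=> M; rewrite lte_fin.
have M0 : (0 < M)%N by near: M; exists 1%N.
rewrite ltr_pdivrMr ?ltr0n// => /ltW; apply: le_trans.
rewrite -big_mkcond /= (eq_bigr (fun=> 1%:R))// -natr_sum ler_nat.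
rewrite sum1_count -size_filter.
set D := E `&` _.
have fD : finite_set D.
  by apply: (sub_finite_set _ (finite_II M.+1)) => k [_ /andP[]].
apply: uniq_leq_size; first by rewrite filter_uniq// iota_uniq.
move=> k; rewrite mem_filter mem_index_iota => /andP[kE k1].
by rewrite in_fset_set// inE; split; [exact: set_mem|].
Unshelve. all: by end_near. Qed.

(** Outside a set of small upper density the two orbits stay within the modulus
    of continuity of [f]; on that set the bound [2 * B] is enough. *)
Lemma mean_L_stable_mean K : mean_L_stable T K -> forall e : R, 0 < e ->
  exists2 d : R, 0 < d & forall x y, K x -> K y -> mdist x y < d ->
    \forall M \near \oo, \sum_(m < M) orbit_gap x y m <= e * M%:R.
Proof.
move=> MLS e e0; have e40 : 0 < e / 4 by rewrite divr_gt0.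
have [d1 d10 hd1] := compact_uniformly_continuous cX cf e40.
have m0 : 0 < Num.min d1 (e / 4 / (2 * B)).
  by rewrite lt_min d10/= divr_gt0// mulr_gt0.
have [d d0 hd] := MLS _ m0; exists d => // x y Kx Ky xy.
have [E dE hE] := hd x y Kx Ky xy.
near=> M.
have cE : \sum_(1 <= n < M.+1) (if n \in E then 1 else 0 : R) <=
    Num.min d1 (e / 4 / (2 * B)) * M%:R.
  by near: M; exact: upper_density_count.
have BM : 2 * B <= e / 4 * M%:R.
  by rewrite -ler_pdivrMl//; near: M; exact: nbhs_infty_ger.
have gap_E m : orbit_gap x y m <= e / 4 + 2 * B * (if m \in E then 1 else 0).
  case: ifPn => [_|/negP mE]; rewrite ?mulr1 ?mulr0 ?addr0.
    by rewrite (le_trans (orbit_gap_le _ _ _))// lerDr ltW.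
  apply: hd1; apply: (@lt_le_trans _ _ (Num.min d1 (e / 4 / (2 * B)))).
    by apply: hE => Em; apply: mE; rewrite inE.
  by rewrite ge_min lexx.
apply: (@le_trans _ _ (\sum_(0 <= m < M.+1) orbit_gap x y m)).
  by rewrite big_mkord big_ord_recr /= lerDl.
rewrite big_nat_recl// -(big_add1 _ _ 0 M.+1 xpredT (orbit_gap x y)).
apply: (@le_trans _ _ (2 * B + \sum_(1 <= m < M.+1)
    (e / 4 + 2 * B * (if m \in E then 1 else 0)))).
  by apply: lerD; [exact: orbit_gap_le|apply: ler_sum => m _; exact: gap_E].
rewrite big_split /= sumr_const_nat subSS subn0 -mulr_sumr.
rewrite -[_ / 4 *+ M]mulr_natr.
have : 2 * B * \sum_(1 <= i < M.+1) (if i \in E then 1 else 0) <= e / 4 * M%:R.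
  have -> : e / 4 * M%:R = 2 * B * (e / 4 / (2 * B) * M%:R).
    by field; rewrite gt_eqF.
  rewrite ler_pM2l ?mulr_gt0// (le_trans cE)// ler_wpM2r//.
  by rewrite ge_min lexx orbT.
have := mulr_ge0 (ltW e0) (ler0n R M).
move: BM; move: (M%:R) => r; move: (2 * B * \sum_(_ <= _ < _) _) => q.
by lra.
Unshelve. all: by end_near. Qed.

Lemma continuous_orbit_gap z m : continuous (fun y => orbit_gap y z m : R^o).
Proof.
move=> y; apply/(@cvgrPdist_le R R^o) => e e0.
have cfm : continuous (f \o iter m T).
  move=> w; apply: continuous_comp; [exact: continuous_iter|exact: cf].
have /cvg_normcP/(_ _ e0) := cfm y.
apply: filterS => w hw; rewrite ler_norml; apply/andP; split.
  have := ler_normc_dist (f (iter m T y)) (f (iter m T w)) (f (iter m T z)).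
  move: hw; rewrite /orbit_gap /=; lra.
have := ler_normc_dist (f (iter m T w)) (f (iter m T y)) (f (iter m T z)).
rewrite (normc_distC (f (iter m T y)) (f (iter m T w))).
move: hw; rewrite /orbit_gap /=; lra.
Qed.

Lemma closed_orbit_gap_mean z (e : R) n :
  closed [set y | forall M, (n <= M)%N ->
    \sum_(m < M) orbit_gap y z m <= e * M%:R].
Proof.
have -> : [set y | forall M, (n <= M)%N ->
    \sum_(m < M) orbit_gap y z m <= e * M%:R] =
    \bigcap_(M in [set M | (n <= M)%N])
      ((fun y => \sum_(m < M) orbit_gap y z m : R^o) @^-1`
        [set r | r <= e * M%:R]).
  by apply/seteqP; split => y h M /= /h.
apply: closed_bigI => M _; apply: preimage_closed; last exact: closed_le.
move=> y _; apply: (@continuous_big R^o _ +%R 0) => //.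
  exact: add_continuous.
by move=> m _; exact: continuous_orbit_gap.
Qed.

Lemma minimal_subset_orbit K x n : minimal_subset T K -> K x -> K (iter n T x).
Proof.
move=> [_ _ TK _] Kx; elim: n => [//|n IH] /=.
by apply: TK; exists (iter n T x).
Qed.

(** By compactness, the time needed to enter a given ball centered in a minimal
    set is bounded, uniformly over starting points close to the set. *)
Lemma minimal_subset_syndetic K w (r : R) :
  minimal_subset T K -> K w -> 0 < r ->
  exists L, forall y, K y -> exists2 l, (l <= L)%N &
    forall y', mdist y y' < L.+1%:R^-1 -> mdist w (iter l T y') < r.
Proof.
move=> minK Kw r0; have [_ clK _ denseK] := minK.
have cK : compact K by apply: subclosed_compact cX _.
pose P (L : nat) y := exists2 l, (l <= L)%N &
  forall y', mdist y y' < L.+1%:R^-1 -> mdist w (iter l T y') < r.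
have [L _ hL] : \forall L \near \oo, K `<=` P L.
  apply: (iffLR (compact_near_coveringP _) cK) => y Ky.
  have [_ [[l _ <-] wl]] := denseK y Ky w Kw _ (near_mdist_lt w r0).
  have /near_mdistP[d d0 hd] : \forall y' \near y, mdist w (iter l T y') < r.
    have rl : 0 < r - mdist w (iter l T y) by rewrite subr_gt0.
    have := @continuous_iter _ _ T l cT y _ (near_mdist_lt _ rl).
    apply: (@filterS _ (nbhs y)) => y' /= h.
    by have := metric_triangle w (iter l T y) (iter l T y'); lra.
  have d20 : 0 < d / 2 by rewrite divr_gt0.
  near=> y1 L => /=; exists l; first by near: L; exists l.
  move=> y' yy'; apply: hd.
  have nd : L.+1%:R^-1 < d / 2.
    by near: L; exact: (near_infty_natSinv_lt (PosNum d20)).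
  have xy : mdist y y1 < d / 2 by near: y1; exact: near_mdist_lt.
  have := lt_trans yy' nd; clear yy' nd.
  by have := metric_triangle y y1 y'; lra.
by exists L => y; exact: (hL L (leqnn _)).
Unshelve. all: by end_near. Qed.

(** Mean-L-stability only bounds the averages of [orbit_gap] for times that may
    depend on the pair of points.  By Baire these times are bounded on a ball,
    and by minimality every orbit reaches that ball after a bounded time. *)
Lemma minimal_uniform_mean_stability K :
  minimal_subset T K -> mean_L_stable T K -> forall e : R, 0 < e ->
  exists2 d : R, 0 < d & exists M0, forall x y, K x -> K y -> mdist x y < d ->
    forall M, (M0 <= M)%N -> \sum_(m < M) orbit_gap x y m <= e * M%:R.
Proof.
move=> minK MLS e e0; have [[z Kz] clK _ _] := minK.
have e40 : 0 < e / 4 by rewrite divr_gt0.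
have e20 : 0 < e / 2 by rewrite divr_gt0.
have [d1 d10 hd1] := mean_L_stable_mean MLS e40.
have [||n [w [Kw [r r0 hr]]]] := closed_cover_interior (F := fun n =>
  [set y | forall M, (n <= M)%N ->
    \sum_(m < M) orbit_gap y z m <= e / 4 * M%:R]) cX clK _ Kz d10 _.
- by move=> n; exact: closed_orbit_gap_mean.
- move=> y Ky; rewrite metric_sym => /(hd1 _ _ Ky Kz)[n _ hn].
  by exists n => M; exact: hn.
have [L hL] := minimal_subset_syndetic minK Kw r0.
have [M1 _ hM1] : \forall M \near \oo, 2 * B * L%:R / (e / 2) <= M%:R :> R.
  exact: nbhs_infty_ger.
exists L.+1%:R^-1 => //; exists (maxn n M1) => x y Kx Ky xy M.
rewrite geq_max => /andP[nM M1M].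
have [l lL hl] := hL x Kx.
rewrite (le_trans (sum_prefix_le l _ (orbit_gap_ge0 x y) (orbit_gap_le x y)))//.
rewrite [e in leRHS]splitr [leRHS]mulrDl; apply: lerD.
  apply: (@le_trans _ _ (2 * B * L%:R)).
    by rewrite ler_pM2l ?mulr_gt0// ler_nat.
  by rewrite -ler_pdivrMl// mulrC; exact: hM1 _ M1M.
have gap_shift m :
    orbit_gap x y (l + m) = orbit_gap (iter l T x) (iter l T y) m.
  by rewrite /orbit_gap addnC !iterD.
under eq_bigr => m _ do rewrite gap_shift.
have hx : \sum_(m < M) orbit_gap (iter l T x) z m <= e / 4 * M%:R.
  apply: (hr _ _ _ M nM); first exact: minimal_subset_orbit.
  by apply: hl; rewrite mdistxx.
have hy : \sum_(m < M) orbit_gap (iter l T y) z m <= e / 4 * M%:R.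
  by apply: (hr _ _ _ M nM); [exact: minimal_subset_orbit|exact: hl].
apply: (@le_trans _ _ (\sum_(m < M) (orbit_gap (iter l T x) z m +
    orbit_gap (iter l T y) z m))).
  apply: ler_sum => m _; rewrite (orbit_gapC (iter l T y)).
  exact: orbit_gap_triangle.
rewrite big_split /=; have := lerD hx hy; move: (M%:R) => q; lra.
Qed.

(** Two times have the same color when the orbit visits the same small piece of
    [K]; uniform mean stability then compares the two futures. *)
Lemma minimal_orbit_weyl_almost_periodic K x :
  minimal_subset T K -> mean_L_stable T K -> K x ->
  weyl_almost_periodic (fun n => f (iter n T x) : R[i]).
Proof.
move=> minK MLS Kx e e0; have [_ clK _ _] := minK.
have [d d0 [M0 hM0]] := minimal_uniform_mean_stability minK MLS e0.
have cK : compact K by apply: subclosed_compact cX _.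
have [|F [kappa hk]] := @compact_coloring X K (fun w y => mdist w y < d / 2) cK.
  by move=> y _; apply: near_mdist_lt; rewrite divr_gt0.
exists F, (fun n => kappa (iter n T x)), M0 => i j.
have Kn n : K (iter n T x) by exact: minimal_subset_orbit.
move=> /(hk _ _ (Kn i) (Kn j))[w [_ wi wj]] M MM0.
have ij : mdist (iter i T x) (iter j T x) < d.
  have := metric_triangle (iter i T x) w (iter j T x).
  by rewrite (metric_sym _ w); lra.
have := hM0 _ _ (Kn i) (Kn j) ij M MM0; apply: le_trans.
rewrite le_eqVlt; apply/orP; left; apply/eqP; apply: eq_bigr => m _.
by rewrite /orbit_gap -!iterD ![(m + _)%N]addnC.
Qed.

Section Weights.
Context (c : nat -> R[i]) (lambda : R).
Context (osc : oscillating c) (lambda1 : 1 < lambda).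
Context (growth : growth_condition c lambda).

Lemma average_orbit_difference (eta : R) : 0 < eta ->
  exists2 eps : R, 0 < eps & \forall N \near \oo, forall x y,
    \sum_(1 <= n < N.+1) orbit_gap x y n <= eps * N%:R ->
    normc (weighted_average c T f N x - weighted_average c T f N y) <= eta.
Proof.
move=> eta0; have BB0 : 0 < 2 * B by rewrite mulr_gt0.
have [eps e0 he] := average_small_factor lambda1 growth BB0 eta0.
exists eps => //; apply: filterS he => N hN x y hxy.
have := hN (fun n => f (iter n T x) - f (iter n T y)).
move=> /(_ (orbit_gap_le x y) hxy); apply: le_trans.
rewrite le_eqVlt; apply/orP; left; apply/eqP; congr normc.
rewrite /weighted_average -[in LHS]mulN1r -averageZ -averageD.
by congr (average _ N); apply/funext => n; ring.
Qed.

Lemma weighted_average_minimal_pointwise K x :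
  minimal_subset T K -> mean_L_stable T K -> K x -> forall eta : R, 0 < eta ->
  \forall N \near \oo, normc (weighted_average c T f N x) <= eta.
Proof.
move=> minK MLS Kx eta eta0.
have ap := minimal_orbit_weyl_almost_periodic minK MLS Kx.
exact: (average_weyl_almost_periodic osc lambda1 growth B0
  (fun n => fB (iter n T x)) ap eta0).
Qed.

(** The weighted averages are equicontinuous on [K] from some time on, so
    that pointwise convergence on the compact [K] is uniform. *)
Lemma weighted_average_minimal_uniform K :
  minimal_subset T K -> mean_L_stable T K -> forall eta : R, 0 < eta ->
  \forall N \near \oo, forall x, K x ->
    normc (weighted_average c T f N x) <= eta.
Proof.
move=> minK MLS eta eta0; have [_ clK _ _] := minK.
have eta20 : 0 < eta / 2 by rewrite divr_gt0.
have cK : compact K by apply: subclosed_compact cX _.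
have [eps e0 he] := average_orbit_difference eta20.
have e20 : 0 < eps / 2 by rewrite divr_gt0.
have [d d0 [M0 hM0]] := minimal_uniform_mean_stability minK MLS e20.
have/compact_near_coveringP/near_covering_withinP ncK := cK.
apply: (ncK _ _ (fun N x => normc (weighted_average c T f N x) <= eta)) => x Kx.
near=> y N => /= Ky.
have N0 : (0 < N)%N by near: N; exists 1%N.
have NM0 : (M0 <= N.+1)%N by near: N; exists M0 => // n /=; exact: leqW.
rewrite -(subrK (weighted_average c T f N x) (weighted_average c T f N y)).
rewrite (le_trans (ler_normcD _ _))// [eta]splitr lerD//; last first.
  by near: N; exact: weighted_average_minimal_pointwise minK MLS Kx _ eta20.
have heN : forall x y, \sum_(1 <= n < N.+1) orbit_gap x y n <= eps * N%:R ->
  normc (weighted_average c T f N x - weighted_average c T f N y) <= eta / 2.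
  by near: N; exact: he.
apply: heN.
have yx : mdist y x < d by rewrite metric_sym; near: y; exact: near_mdist_lt.
apply: (@le_trans _ _ (eps / 2 * N.+1%:R)).
  apply: le_trans (hM0 _ _ Ky Kx yx _ NM0).
  by rewrite -(big_mkord xpredT (orbit_gap y x)) big_ltn// lerDr.
rewrite -mulrA ler_pM2l// mulrC ler_pdivrMr// mulr_natr -mulrnA ler_nat.
by lia.
Unshelve. all: by end_near. Qed.

(** A point mean attracted to [K] has the same weighted averages, up to a small
    error, as some point of [K]. *)
Lemma weighted_average_basin K x :
  minimal_subset T K -> mean_L_stable T K -> basin T K x ->
  forall eta : R, 0 < eta ->
  \forall N \near \oo, normc (weighted_average c T f N x) <= eta.
Proof.
move=> minK MLS xK eta eta0.
have eta20 : 0 < eta / 2 by rewrite divr_gt0.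
have [eps e0 he] := average_orbit_difference eta20.
have e20 : 0 < eps / 2 by rewrite divr_gt0.
have [d d0 hd] := compact_uniformly_continuous cX cf e20.
(* beyond the modulus of continuity, [orbit_gap] is at most [2 * B / d] times
   the distance *)
have s0 : 0 < eps / 2 / (2 * B / d) by rewrite !divr_gt0// mulr_gt0.
have [z Kz /limn_esup_lt_near hz] := xK _ s0.
near=> N.
have N0 : (0 < N)%N by near: N; exists 1%N.
rewrite -(subrK (weighted_average c T f N z) (weighted_average c T f N x)).
rewrite (le_trans (ler_normcD _ _))// [eta]splitr lerD//; last first.
  by near: N; exact: weighted_average_minimal_pointwise minK MLS Kz _ eta20.
have heN : forall x y, \sum_(1 <= n < N.+1) orbit_gap x y n <= eps * N%:R ->
  normc (weighted_average c T f N x - weighted_average c T f N y) <= eta / 2.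
  by near: N; exact: he.
apply: heN.
have : ((average (fun n => mdist (iter n T x) (iter n T z)) N)%:E <
    (eps / 2 / (2 * B / d))%:E)%E by near: N; exact: hz.
rewrite lte_fin /average mulrC ltr_pdivrMr ?ltr0n// => /ltW hzN.
apply: (@le_trans _ _ (\sum_(1 <= n < N.+1) (eps / 2 +
    2 * B / d * mdist (iter n T x) (iter n T z)))).
  apply: ler_sum => n _.
  have [near_nz|far] := ltP (mdist (iter n T x) (iter n T z)) d.
    rewrite (le_trans (hd _ _ near_nz))// lerDl.
    by rewrite mulr_ge0 ?mdist_ge0// divr_ge0 ?mulr_ge0// ltW.
  rewrite (le_trans (orbit_gap_le x z n))//.
  apply: (@le_trans _ _ (2 * B / d * mdist (iter n T x) (iter n T z))).
    rewrite [leLHS](_ : _ = 2 * B / d * d); last by field; rewrite gt_eqF.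
    by rewrite ler_pM2l// divr_gt0// mulr_gt0.
  by rewrite lerDr ltW.
rewrite big_split /= sumr_const_nat subSS subn0 -mulr_sumr.
rewrite -[_ / 2 *+ N]mulr_natr.
rewrite [eps in leRHS]splitr [leRHS]mulrDl lerD2l.
have -> : eps / 2 * N%:R = 2 * B / d * (eps / 2 / (2 * B / d) * N%:R).
  by field; rewrite !gt_eqF.
by rewrite ler_pM2l// divr_gt0// mulr_gt0.
Unshelve. all: by end_near. Qed.

End Weights.
End MinimalFlow.

(** * Linear disjointness *)

Unset Implicit Arguments.

Theorem theorem1 (R : realType) (c : nat -> R[i])
    (hosc : oscillating c)
    (hgrowth : exists2 lambda : R, 1 < lambda & growth_condition c lambda)
    (X : metricType R) (hX : compact [set: X])
    (T : X -> X) (hT : continuous T)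
    (hMMA : MMA T) (hMMLS : MMLS T) :
  linearly_disjoint c T /\
  (forall f : X -> R[i]^o, continuous f ->
    (forall x : X, weighted_average c T f ^~ x @ \oo --> (0 : R[i]^o)) /\
    (forall K : set X, minimal_subset T K ->
       {uniform K, weighted_average c T f @ \oo --> (fun _ : X => (0 : R[i]^o))})).
Proof.
have [lambda lambda1 growth] := hgrowth.
have pointwise (f : X -> R[i]^o) : continuous f -> forall x : X,
    weighted_average c T f ^~ x @ \oo --> (0 : R[i]^o).
  move=> cf x; apply/cvg_normcP => eta eta0.
  have [B B0 fB] := compact_bounded_modulus hX cf.
  have : [set: X] x by [].
  rewrite hMMA => -[K minK xK].
  have := weighted_average_basin hX hT cf B0 fB hosc lambda1 growth minK
    (hMMLS K minK) xK eta0.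
  by apply: filterS => N; rewrite subr0.
split; first exact: pointwise.
move=> f cf; split; first exact: pointwise.
move=> K minK; have [B B0 fB] := compact_bounded_modulus hX cf.
move=> P /uniform_nbhs[E [entE EP]].
have [[e i] /= e0 eE] : filter_from [set x : R[i] | 0 < x]
    (fun e : R[i] => [set xy : R[i]^o * R[i]^o | ball xy.1 e xy.2]) E.
  by rewrite entourage_from_ballE.
have /andP[/eqP i0 e1] : (i == 0) && (0 < e) by move: e0; rewrite ltcE.
have e20 : 0 < e / 2 by rewrite divr_gt0.
have := weighted_average_minimal_uniform hX hT cf B0 fB hosc lambda1 growth minK
  (hMMLS K minK) e20.
apply: filterS => N hN; apply: EP => x Kx; apply: eE => /=.
rewrite /ball /= sub0r normrN normr_normc i0 ltcR.
by apply: le_lt_trans (hN x Kx) _; lra.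
Qed.
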